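(* Let $0<\varepsilon<1$ and let $n,t$ be positive integers such that $t<(1+\varepsilon)^n$. Assume that $A=\{a_1,a_2,\ldots,a_n\}$ is an $n$-element set of positive integers in which the sums of all its subsets are distinct modulo $N=2^n+t$. Then $$\max A \ge (1-\varepsilon)\frac{N}{3}.$$ Furthermore, the constant $1/3$ is optimal, in the following sense: there exist a sequence of positive integers $n_k\to\infty$, positive integers $N_k$ with $N_k=(1+o(1))2^{n_k}$ as $k\to\infty$, and $n_k$-element sets $A_k$ of positive integers that are sumset-distinct modulo $N_k$, such that $\max A_k\le \left(\frac13+o(1)\right)N_k$ as $k\to\infty$.
   Context: A finite set of integers is called sumset-distinct modulo $N$ if all of its subsets (including the empty set, whose sum is $0$) have pairwise distinct sums modulo $N$. *)

(* Defs.v *)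
From HB Require Import structures.
From mathcomp Require Import all_boot all_order all_algebra finmap.
From mathcomp Require Import all_classical all_reals all_analysis.

Set Implicit Arguments.
Unset Strict Implicit.
Unset Printing Implicit Defensive.

Import Order.TTheory GRing.Theory Num.Theory.
Import numFieldNormedType.Exports.

Local Open Scope ring_scope.

Definition sumset_distinct (N : nat) (A : {fset int}) : Prop :=
  forall B C : {fset int}, (B `<=` A)%fset -> (C `<=` A)%fset ->
    (\sum_(b <- B) b = \sum_(c <- C) c %[mod N])%Z -> B = C.

Definition all_positive (A : {fset int}) : Prop :=
  forall a : int, a \in A -> 0 < a.

(* The default value 0 makes this the maximum of A only when A has a
   nonnegative element, as every nonempty set of positive integers does. *)
Definition max_elt (A : {fset int}) : int := \big[Order.max/0]_(a <- A) a.

(* Main.v *)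
Require Import Defs.
From HB Require Import structures.
From mathcomp Require Import all_boot all_order all_algebra finmap.
From mathcomp Require Import all_classical all_reals all_analysis.
From mathcomp Require Import ring lra zify.

Set Implicit Arguments.
Unset Strict Implicit.
Unset Printing Implicit Defensive.

Import Order.TTheory GRing.Theory Num.Theory.
Import numFieldNormedType.Exports.

Local Open Scope classical_set_scope.
Local Open Scope ring_scope.

(** The lower bound is a Fourier argument at the single frequency 1. Put
    th = pi / N and expand the product of the 2 cos(th a), a in A, into a sum
    over subsets B of A of cosines cos(2 th s(B) - psi), where s(B) is the sum
    of B and psi = th s(A) ([sum_cos_subseqs]). The value of such a cosine only
    depends on s(B) modulo N, and the 2^n residues s(B) are distinct. Over all
    N residues these cosines add up to 0 ([sum_cos_residues]), so the product
    is, up to sign, the sum over the t = N - 2^n residues that are missed, hence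
    at most t in absolute value ([prod_cos_le]). If all elements of A were below
    (1 - eps) N / 3, every factor 2 cos(th a) would be at least 1 + eps, because
    on [0, pi / 3] the concave function cos lies above its chord
    ([cos_ge_chord]); the product would then be at least (1 + eps)^n > t.

    For optimality, the idea is that doubling modulo N almost preserves
    {N / 3, 2 N / 3}, and that replacing a by - a does not change whether all
    signed sums are nonzero. Take m odd, b = 2^m + 1 (a multiple of 3),
    N = 2^m b + 1 and u = (N - 1) / 3. Modulo N, multiplication by -3 sends
    the integers u + (1 - (-2)^i) / 3 to (-2)^i and 2^j b / 3 to - 2^j b. For
    i, j < m these images have no vanishing signed sum modulo N: such a sum is
    X - b Y with |X|, |Y| < 2^m, so its absolute value is less than N, and
    X = b Y forces Y = 0, X = 0 and then all digits to be 0
    ([third_family_dissociated]). The 2m integers obtained are at most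
    (N + 2^m) / 3, while N = 2^(2m) + 2^m + 1 ([third_family_bounds]). *)

(** * Subsequences of a sequence *)

(** All subsequences, listed by position; for a duplicate-free sequence this
    enumerates the subsets, in a form suited to induction. *)
Fixpoint subseqs (T : Type) (s : seq T) : seq (seq T) :=
  if s is x :: s' then subseqs s' ++ map (cons x) (subseqs s') else [:: [::]].

Lemma size_subseqs (T : Type) (s : seq T) : size (subseqs s) = (2 ^ size s)%N.
Proof.
by elim: s => //= x s IHs; rewrite size_cat size_map IHs expnS mul2n addnn.
Qed.

Lemma subseqs_subseq (T : eqType) (s t : seq T) : t \in subseqs s -> subseq t s.
Proof.
elim: s t => [|x s IHs] t /=; first by rewrite inE => /eqP ->.
rewrite mem_cat => /orP[/IHs ts|/mapP[t' /IHs ts ->]]; last by rewrite /= eqxx.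
exact: subseq_trans ts (subseq_cons s x).
Qed.

Lemma subseqs_uniq (T : eqType) (s : seq T) : uniq s -> uniq (subseqs s).
Proof.
elim: s => //= x s IHs /andP[xs us]; rewrite cat_uniq IHs// map_inj_uniq ?IHs//.
  rewrite andbT; apply/hasPn => _ /mapP[t ts ->]; apply/negP => /subseqs_subseq.
  by move=> /mem_subseq /(_ x); rewrite mem_head (negbTE xs) => /(_ isT).
by move=> t1 t2 [].
Qed.

(** * Cosine estimates and cosine sums *)

(** The double angle 2 pi / 3 is also pi - pi / 3, so c = cos(pi / 3) satisfies
    2 c^2 - 1 = - c, whose only positive root is 1 / 2. *)
Lemma cos_pi3 (R : realType) : cos (pi / 3) = 1 / 2 :> R.
Proof.
have pi0 := @pi_gt0 R.
have c0 : 0 < cos (pi / 3) :> R by apply: cos_gt0_pihalf; lra.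
have e : cos (pi / 3 *+ 2) = - cos (pi / 3) :> R.
  by rewrite -[in RHS]cosN -cosDpi; congr cos; rewrite -mulr_natr; field.
move: e; rewrite cos_mulr2n => e.
have : (2 * cos (pi / 3) - 1) * (cos (pi / 3) + 1) = 0 :> R.
  by move: e; set c := cos _; rewrite expr2; nra.
by move=> /eqP; rewrite mulf_eq0 => /orP[] /eqP; lra.
Qed.

(** Concavity of cos on [0, pi / 3], through the two mean slopes on either side
    of x: the left one is - sin c, the right one - sin d with c <= x <= d, and
    sin is increasing there. *)
Lemma cos_ge_chord (R : realType) (x : R) :
  0 <= x <= pi / 3 -> 1 - x / (pi / 3) / 2 <= cos x.
Proof.
move=> /andP[x0 xp]; have pi0 := @pi_gt0 R.
have dcos (a b : R) y : y \in `]a, b[ -> is_derive y 1 cos (- sin y).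
  by move=> _; exact: is_derive_cos.
have ccos (a b : R) : {within `[a, b], continuous cos}.
  by apply: continuous_subspaceT; exact: continuous_cos.
have [c + e1] := MVT_segment x0 (@dcos 0 x) (@ccos 0 x).
have [d + e2] := MVT_segment xp (@dcos x (pi / 3)) (@ccos x (pi / 3)).
rewrite !in_itv /= => /andP[d1 d2] /andP[c1 c2].
have scd : sin c <= sin d.
  by rewrite leNgt ltr_sin ?in_itv /=; lra.
move: e1 e2; rewrite cos0 cos_pi3.
set p := pi / 3 in xp d2 *; have p0 : 0 < p by rewrite /p; lra.
move: scd; set s1 := sin c; set s2 := sin d; set C := cos x => s12 e1 e2.
have h : 0 <= (s2 - s1) * (x * (p - x)) by rewrite !mulr_ge0 ?subr_ge0.
have e3 : (1 - C) * (p - x) = s1 * x * (p - x).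
  by congr (_ * _); lra.
have e4 : x * (C - 1 / 2) = s2 * (p - x) * x by rewrite mulrC; congr (_ * _); lra.
have : (1 - C) * p <= x / 2 by nra.
by rewrite -ler_pdivlMr// => ?; lra.
Qed.

(** Real form of the expansion of the product of the 1 + z^a. The phase phi is
    there for the induction: adding an element a splits phi into phi - th a and
    phi + th a, and cos(phi - th a) + cos(phi + th a) = 2 cos phi cos(th a). *)
Lemma sum_cos_subseqs (R : realType) (th phi : R) (s : seq int) :
  \sum_(t <- subseqs s)
     cos (th * 2 * (\sum_(a <- t) a)%:~R - th * (\sum_(a <- s) a)%:~R + phi) =
  cos phi * \prod_(a <- s) (2 * cos (th * a%:~R)).
Proof.
elim: s phi => [|a s IHs] phi.
  by rewrite !big_cons !big_nil /= !mulr0 !mulr1 subr0 add0r addr0.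
rewrite /= big_cat big_map /=.
rewrite (eq_bigr (fun t => cos (th * 2 * (\sum_(a <- t) a)%:~R -
   th * (\sum_(a <- s) a)%:~R + (phi - th * a%:~R)))); last first.
  by move=> t _; congr cos; rewrite big_cons rmorphD /=; ring.
rewrite IHs (eq_bigr (fun t => cos (th * 2 * (\sum_(a <- t) a)%:~R -
   th * (\sum_(a <- s) a)%:~R + (phi + th * a%:~R)))); last first.
  by move=> t _; congr cos; rewrite !big_cons !rmorphD /=; ring.
by rewrite IHs big_cons cosB cosD; ring.
Qed.

(** Multiplied by 2 sin(pi / N), which is nonzero since N > 1, the sum
    telescopes over one full period. *)
Lemma sum_cos_residues (R : realType) (N : nat) (psi : R) : (1 < N)%N ->
  \sum_(m <- iota 0 N) cos (pi / N%:R * 2 * m%:R - psi) = 0.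
Proof.
move=> N1; have pi0 := @pi_gt0 R.
have N1R : 1 < N%:R :> R by rewrite ltr1n.
set th := pi / N%:R.
have s0 : sin th != 0.
  rewrite gt_eqF// sin_gt0_pi// /th divr_gt0 ?ltr_pdivrMr//; [|lra..].
  by rewrite ltr_pMr.
have step m : cos (th * 2 * m%:R - psi) * (2 * sin th) =
    sin (th * 2 * m.+1%:R - psi - th) - sin (th * 2 * m%:R - psi - th).
  have -> : th * 2 * m.+1%:R - psi - th = (th * 2 * m%:R - psi) + th.
    by rewrite -(natr1 m); ring.
  by rewrite (sinD _ th) (sinB _ th); ring.
apply: (mulIf s0); rewrite mul0r; apply: (mulIf (_ : 2 != 0)); rewrite ?pnatr_eq0//.
rewrite mul0r -mulrA (mulrC (sin _)) mulr_suml -{1}(subn0 N) -/(index_iota 0 N).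
under eq_bigr do rewrite step.
rewrite (telescope_sumr (fun m => sin (th * 2 * m%:R - psi - th)))//.
have -> : th * 2 * N%:R - psi - th = (th * 2 * 0%:R - psi - th) + pi *+ 2.
  by rewrite /th; field; lra.
by rewrite sinD2pi subrr.
Qed.

Lemma cos_modz (R : realType) (N : nat) (v : int) (psi : R) : (0 < N)%N ->
  cos (pi / N%:R * 2 * (`|(v %% N)%Z|%N)%:R - psi) =
  cos (pi / N%:R * 2 * v%:~R - psi).
Proof.
move=> N0; have N0R : N%:R != 0 :> R by rewrite pnatr_eq0 -lt0n.
have periodic_int k a : cos (a + (pi *+ 2) *~ k) = cos a :> R.
  case: k => k; first exact: periodicn (@cosD2pi R) k a.
  by rewrite NegzE mulrNz -(periodicn (@cosD2pi R) k.+1) subrK.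
rewrite -(periodic_int (v %/ N)%Z); congr cos.
have -> : (`|(v %% N)%Z|%N)%:R = ((v %% N)%Z)%:~R :> R.
  by rewrite natr_absz ger0_norm ?modz_ge0//; lia.
have -> : v%:~R = (v %/ N)%Z%:~R * N%:R + (v %% N)%Z%:~R :> R.
  by rewrite {1}(divz_eq v N) intrD intrM.
rewrite -mulrzr -mulr_natr; by field.
Qed.

(** * The lower bound *)

(** The product equals the sum of the cosines over the residues that are subset
    sums; as the sum over all residues vanishes, it is minus the sum over the
    N - 2^|A| remaining ones, each of absolute value at most 1. *)
Lemma prod_cos_le (R : realType) (N : nat) (A : {fset int}) :
  (1 < N)%N -> sumset_distinct N A ->
  `|\prod_(a <- A) (2 * cos (pi / N%:R * a%:~R : R))| <= N%:R - 2 ^+ #|` A|.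
Proof.
move=> N1 sdA; have N0 : (0 < N)%N by exact: ltnW.
pose psi : R := pi / N%:R * (\sum_(a <- A) a)%:~R.
pose c m : R := cos (pi / N%:R * 2 * m%:R - psi).
pose r (t : seq int) := `|((\sum_(a <- t) a)%R %% N)%Z|%N.
pose L := map r (subseqs A).
have rE t : (r t)%:Z = ((\sum_(a <- t) a)%R %% N)%Z.
  by rewrite /r gez0_abs// modz_ge0//; lia.
have r_lt t : (r t < N)%N.
  have : ((\sum_(a <- t) a)%R %% N)%Z < N by rewrite ltz_pmod//; lia.
  by rewrite -rE.
have uL : uniq L.
  rewrite map_inj_in_uniq ?subseqs_uniq ?fset_uniq// => t1 t2.
  move=> /subseqs_subseq s1 /subseqs_subseq s2 /(congr1 Posz); rewrite !rE => r12.
  have sumE t : subseq t A -> \sum_(b <- [fset x in t]%fset) b = \sum_(b <- t) b.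
    move=> st; apply: perm_big; apply: uniq_perm; rewrite ?fset_uniq//.
      exact: subseq_uniq st (fset_uniq A).
    by move=> x; rewrite !inE.
  have sub t : subseq t A -> ([fset x in t] `<=` A)%fset.
    by move=> /mem_subseq tA; apply/fsubsetP => x; rewrite !inE => /tA.
  have : [fset x in t1]%fset = [fset x in t2]%fset.
    by apply: sdA; rewrite ?sub// !sumE.
  move=> /fsetP t12.
  rewrite (subseq_uniqP (fset_uniq A) s1) (subseq_uniqP (fset_uniq A) s2).
  by apply: eq_filter => x; have := t12 x; rewrite !inE.
have -> : \prod_(a <- A) (2 * cos (pi / N%:R * a%:~R)) = \sum_(m <- L) c m.
  have := @sum_cos_subseqs R (pi / N%:R) 0 A; rewrite cos0 mul1r => <-.
  by rewrite big_map; apply: eq_bigr => t _; rewrite addr0 /c /r cos_modz.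
have permL : perm_eq L (seq.filter (mem L) (iota 0 N)).
  apply: uniq_perm; rewrite ?filter_uniq ?iota_uniq// => m.
  rewrite mem_filter mem_iota add0n leq0n /=; apply/idP/andP => [mL|[]//].
  by split=> //; case/mapP: mL => t _ ->.
have := sum_cos_residues psi N1; rewrite (bigID (mem L)) /= -/(c _).
rewrite -big_filter -(perm_big _ permL) /= => /eqP; rewrite addr_eq0 => /eqP ->.
rewrite normrN (le_trans (ler_norm_sum _ _ _))//.
apply: (@le_trans _ _ (\sum_(m <- iota 0 N | m \notin L) 1)).
  by apply: ler_sum => m _; exact: cos_max.
have szL : size L = (2 ^ #|` A|)%N by rewrite size_map size_subseqs.
have : (count (mem L) (iota 0 N) + count (predC (mem L)) (iota 0 N) = N)%N.
  by rewrite count_predC size_iota.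
rewrite -size_filter -(perm_size permL) szL => /(congr1 (fun n => n%:R : R)).
rewrite natrD natrX => <-; rewrite addrAC subrr add0r.
by rewrite -big_filter big_const_seq count_predT size_filter iter_addr_0.
Qed.

(** If every a were below (1 - eps) N / 3, the angles pi a / N would be below
    (1 - eps) pi / 3, where the chord bound makes each factor at least 1 + eps,
    contradicting [prod_cos_le]. *)
Lemma max_elt_ge (R : realType) (eps : R) (n t : nat) (A : {fset int}) :
  0 < eps -> eps < 1 -> t%:R < (1 + eps) ^+ n -> (0 < n)%N ->
  #|` A| = n -> all_positive A -> sumset_distinct (2 ^ n + t)%N A ->
  (1 - eps) * ((2 ^ n + t)%N%:R / 3) <= (max_elt A)%:~R.
Proof.
move=> e0 e1 tn n0 An posA sdA; rewrite leNgt; apply/negP => maxA.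
set N := (2 ^ n + t)%N in sdA maxA *.
have N1 : (1 < N)%N.
  by rewrite /N (leq_trans _ (leq_addr _ _))// -{1}(expn0 2) ltn_exp2l.
have N0R : 0 < N%:R :> R by rewrite ltr0n ltnW.
have pi0 := @pi_gt0 R.
have := prod_cos_le R N1 sdA.
have Nt : N%:R - 2 ^+ n = t%:R :> R by rewrite natrD natrX addrAC subrr add0r.
rewrite An Nt leNgt => /negP; apply.
rewrite (lt_le_trans tn)//.
have ratio_pi (p M x : R) : p != 0 -> M != 0 -> p / M * x / (p / 3) = x / (M / 3).
  by move=> p0 M0; field; rewrite M0 p0.
have cosA (a : int) : a \in A -> 1 + eps <= 2 * cos (pi / N%:R * a%:~R).
  move=> aA; have a0 : 0 < a%:~R :> R by rewrite ltr0z posA.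
  have aN : a%:~R < (1 - eps) * (N%:R / 3) :> R.
    by rewrite (le_lt_trans _ maxA)// ler_int; exact: le_bigmax_seq.
  have y0 : 0 <= pi / N%:R * a%:~R :> R by rewrite !mulr_ge0 ?invr_ge0 ?ltW.
  have yl : pi / N%:R * a%:~R / (pi / 3) <= 1 - eps.
    have -> : pi / N%:R * a%:~R / (pi / 3) = a%:~R / (N%:R / 3) :> R.
      by apply: ratio_pi; rewrite gt_eqF.
    by rewrite ler_pdivrMr ?divr_gt0// ltW.
  have := @cos_ge_chord R (pi / N%:R * a%:~R); rewrite y0 /=.
  have -> : pi / N%:R * a%:~R <= pi / 3 :> R.
    by move: yl; rewrite ler_pdivrMr ?divr_gt0//; nra.
  by move=> /(_ isT); lra.
rewrite -An ger0_norm.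
  have -> : (1 + eps) ^+ #|` A| = \prod_(a <- A) (1 + eps).
    by rewrite big_const_seq count_predT iter_mulr_1.
  by rewrite !big_seq; apply: ler_prod => a /cosA aC; apply/andP; split; [lra|exact: aC].
by rewrite big_seq prodr_ge0// => a /cosA; lra.
Qed.

(** * Families with no vanishing signed sum *)

(** A signed sum of a family is a difference of two subset sums, so this is
    sumset-distinctness of an indexed family; in this form the property is
    visibly preserved by sign changes and by multiplication by a unit modulo N. *)
Definition dissociated (N n : nat) (f : 'I_n -> int) : Prop :=
  forall e : 'I_n -> int, (forall i, `|e i| <= 1) ->
    (N %| \sum_i e i * f i)%Z -> forall i, e i = 0.

(** Otherwise f i - f j would be a vanishing signed sum. *)
Lemma dissociated_inj (N n : nat) (f : 'I_n -> int) :
  dissociated N f -> injective f.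
Proof.
move=> df i j fij; apply/eqP; rewrite -[_ == _]negbK; apply/negP => ij.
have := df (fun k => (k == i)%:Z - (k == j)%:Z).
have -> : \sum_k ((k == i)%:Z - (k == j)%:Z) * f k = 0.
  under eq_bigr do rewrite mulrBl.
  rewrite sumrB (bigD1 i)//= [X in _ - X](bigD1 j)//= !eqxx !mul1r.
  rewrite !big1 ?addr0 ?fij ?subrr// => k /negbTE ->; by rewrite mul0r.
rewrite dvdz0 => /(_ _ isT i); rewrite eqxx (negbTE ij) => H.
suff : 1%:Z - 0%:Z = 0 by [].
by apply: H => k; case: eqP; case: eqP.
Qed.

Lemma dissociated_card (N n : nat) (f : 'I_n -> int) :
  dissociated N f -> #|` [fset f i | i in 'I_n]%fset| = n.
Proof.
by move=> /dissociated_inj fi; rewrite card_imfset//= -cardE card_ord.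
Qed.

(** Subsets B and C with congruent sums give a vanishing signed sum whose i-th
    coefficient is the difference of the indicators of B and C at f i. *)
Lemma dissociated_distinct (N n : nat) (f : 'I_n -> int) :
  dissociated N f -> sumset_distinct N [fset f i | i in 'I_n]%fset.
Proof.
move=> df B C BA CA; have fi := dissociated_inj df.
have sumE (D : {fset int}) : (D `<=` [fset f i | i in 'I_n])%fset ->
    \sum_(d <- D) d = \sum_i (f i \in D)%:Z * f i.
  move=> DA.
  have perm_D :
      perm_eq D (map f (seq.filter (fun i => f i \in D) (index_enum 'I_n))).
    apply: uniq_perm; first exact: fset_uniq.
      by rewrite map_inj_uniq ?filter_uniq ?index_enum_uniq.
    move=> d; apply/idP/mapP => [dD|[i + ->]]; last by rewrite mem_filter => /andP[].
    have /imfsetP[i _ di] := fsubsetP DA _ dD.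
    by exists i => //; rewrite mem_filter mem_index_enum -di dD.
  rewrite (perm_big _ perm_D) big_map big_filter big_mkcond /=.
  by apply: eq_bigr => i _; case: ifP => _; rewrite ?mul1r ?mul0r.
move=> /eqP; rewrite eqz_mod_dvd sumE// sumE// -sumrB.
under eq_bigr do rewrite -mulrBl.
move=> /df e0; apply/fsetP => d.
have memE i : (f i \in B) = (f i \in C).
  have := e0 _ i; case: (f i \in B); case: (f i \in C) => // H.
    suff : 1%:Z - 0%:Z = 0 by [].
    by apply: H => j; case: (f j \in B); case: (f j \in C).
  suff : 0%:Z - 1%:Z = 0 by [].
  by apply: H => j; case: (f j \in B); case: (f j \in C).
apply/idP/idP => [dB|dC].
  by have /imfsetP[i _ di] := fsubsetP BA _ dB; rewrite di -memE -di.
by have /imfsetP[i _ di] := fsubsetP CA _ dC; rewrite di memE -di.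
Qed.

(** * Signed digits in base 2 or -2 *)

Lemma signed_digits_bound (b : int) (m : nat) (e : 'I_m -> int) :
  `|b| = 2 -> (forall i, `|e i| <= 1) -> `|\sum_i e i * b ^+ i| < 2 ^+ m.
Proof.
move=> b2; elim: m e => [|m IHm] e e1; first by rewrite big_ord0.
rewrite big_ord_recr /=; set S := \sum_i _.
have : `|S| < 2 ^+ m by apply: IHm => i; exact: e1.
have : `|e ord_max * b ^+ m| <= 2 ^+ m.
  by rewrite normrM normrX b2 ler_piMl// exprn_ge0.
by have := ler_normD S (e ord_max * b ^+ m); rewrite exprS; lra.
Qed.

(** The lowest digit is even, hence 0; divide by the base and repeat. *)
Lemma signed_digits_eq0 (b : int) (m : nat) (e : 'I_m -> int) :
  `|b| = 2 -> (forall i, `|e i| <= 1) -> \sum_i e i * b ^+ i = 0 ->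
  forall i, e i = 0.
Proof.
move=> b2; elim: m e => [|m IHm] e e1; first by move=> _ [].
rewrite big_ord_recl /= expr0 mulr1.
under eq_bigr do rewrite /bump /= add1n exprS mulrCA.
rewrite -mulr_sumr; set S := \sum_i _ => H.
have e00 : e ord0 = 0.
  by have := e1 ord0; lia.
have S0 : S = 0 by lia.
move=> i; case: (unliftP ord0 i) => [j ->|-> //].
by apply: (IHm (fun j => e (lift ord0 j))).
Qed.

(** * A family with elements near one third of the modulus *)

(** The integers (1 - (-2)^i) / 3 = 0, 1, -1, 3, -5, 11, written as a geometric
    sum to avoid the division. They are the signed Jacobsthal numbers. *)
Definition jacobsthal (i : nat) : int := \sum_(k < i) (-2) ^+ k.

Lemma jacobsthalE i : 3 * jacobsthal i = 1 - (-2) ^+ i.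
Proof. by have := subrX1 (-2 : int) i; rewrite -/(jacobsthal i); lia. Qed.

(** For odd m this is (N - 1) / 3 for N = [third_modulus m]. *)
Definition third (m : nat) : int := 2 ^+ m * jacobsthal m.

(** The numbers u + (1 - (-2)^i) / 3, with u = [third m], satisfy
    a_(i+1) = - 2 a_i modulo N = 3 u + 1 and so form, up to sign, a doubling
    sequence starting at u. Continued to length 2m it would drift away from N / 3,
    so the second half consists instead of the 2^j (2^m + 1) / 3, j < m, which
    are less than u; here (2^m + 1) / 3 is [jacobsthal m] for odd m. *)
Definition third_family (m : nat) (i : 'I_(m + m)) : int :=
  match fintype.split i with
  | inl i => third m + jacobsthal i
  | inr j => 2 ^+ j * jacobsthal m
  end.

Definition third_modulus (m : nat) : nat := (2 ^ m * (2 ^ m).+1).+1.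

Lemma jacobsthal_odd m : odd m -> 3 * jacobsthal m = 2 ^+ m + 1.
Proof. by move=> m_odd; rewrite jacobsthalE exprNn -signr_odd m_odd expr1; lia. Qed.

Lemma third_modulusE m : odd m -> (third_modulus m)%:Z = 3 * third m + 1.
Proof.
move=> m_odd; rewrite /third mulrCA jacobsthal_odd// /third_modulus -addn1 PoszD PoszM.
by rewrite -[(2 ^ m).+1]addn1 PoszD -[(2 ^ m)%N%:Z]natz natrX.
Qed.

(** Let X and Y be the integers with signed digits e in base -2 and 2 coming
    from the two halves. Multiplied by 3, a signed sum of the family becomes
    - X + (2^m + 1) Y modulo N, and this is too small to be a nonzero multiple
    of N. So X = (2^m + 1) Y, where |X| <= 2^m, whence Y = 0 and X = 0. *)
Lemma third_family_dissociated m :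
  odd m -> dissociated (third_modulus m) (@third_family m).
Proof.
move=> m_odd e e1; have qE := jacobsthal_odd m_odd.
have NuE := third_modulusE m_odd.
rewrite big_split_ord /= /third_family.
under eq_bigr do rewrite (unsplitK (inl _)).
under [X in _ + X]eq_bigr do rewrite (unsplitK (inr _)).
pose X := \sum_(i < m) e (lshift m i) * (-2) ^+ i.
pose Y := \sum_(i < m) e (rshift m i) * 2 ^+ i.
set S := \sum_(i < m) _; set T := \sum_(i < m) _ => dv.
have HS : 3 * S = (third_modulus m)%:Z * (\sum_(i < m) e (lshift m i)) - X.
  rewrite /S /X !mulr_sumr -sumrB; apply: eq_bigr => i _.
  by have := jacobsthalE i; nia.
have HT : 3 * T = (2 ^+ m + 1) * Y.
  rewrite /T /Y !mulr_sumr; apply: eq_bigr => i _.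
  by rewrite -qE; ring.
have Xb : `|X| < 2 ^+ m by exact: signed_digits_bound.
have Yb : `|Y| < 2 ^+ m by exact: signed_digits_bound.
have dXY : ((third_modulus m)%:Z %| X - (2 ^+ m + 1) * Y)%Z.
  have -> : X - (2 ^+ m + 1) * Y =
      (third_modulus m)%:Z * (\sum_(i < m) e (lshift m i)) - 3 * (S + T) by lia.
  by apply: rpredB; [exact: dvdz_mulr|exact: dvdz_mull].
have NE : (third_modulus m)%:Z = 2 ^+ m * (2 ^+ m + 1) + 1.
  by rewrite NuE /third mulrCA qE.
have M1 : 1 <= 2 ^+ m :> int by rewrite exprn_ege1.
have bYE : `|(2 ^+ m + 1) * Y| = (2 ^+ m + 1) * `|Y|.
  by rewrite normrM ger0_norm//; lia.
have XY0 : X - (2 ^+ m + 1) * Y = 0.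
  move: dXY => /dvdzP[k kE].
  have : `|k| * (third_modulus m)%:Z < (third_modulus m)%:Z.
    have -> : `|k| * (third_modulus m)%:Z = `|X - (2 ^+ m + 1) * Y|.
      by rewrite kE normrM.
    apply: le_lt_trans (ler_normB _ _) _; rewrite bYE NE.
    have : (2 ^+ m + 1) * `|Y| <= (2 ^+ m + 1) * (2 ^+ m - 1).
      by rewrite ler_wpM2l; lia.
    lia.
  rewrite gtr_pMl ?NE; last by lia.
  by move=> k1; rewrite kE (_ : k = 0) ?mul0r//; lia.
have Y0 : Y = 0.
  apply/eqP/negPn/negP => Yn0.
  have : (2 ^+ m + 1) * 1 <= (2 ^+ m + 1) * `|Y| by rewrite ler_wpM2l; lia.
  by rewrite -bYE (_ : _ * Y = X); lia.
have X0 : X = 0 by move: XY0; rewrite Y0 mulr0 subr0.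
move=> i; case: (split_ordP i) => j ->.
  exact: (signed_digits_eq0 (e := fun i => e (lshift m i)) _ _ X0).
exact: (signed_digits_eq0 (e := fun i => e (rshift m i)) _ _ Y0).
Qed.

(** The first half stays within (2^m + 1) / 3 of [third m] since |(-2)^i| is at
    most 2^m, and the second half does not exceed [third m]. *)
Lemma third_family_bounds m i : odd m ->
  0 < @third_family m i /\ 3 * third_family i <= (third_modulus m)%:Z + 2 ^+ m.
Proof.
move=> m_odd; have qE := jacobsthal_odd m_odd.
rewrite (third_modulusE m_odd) /third_family.
have M1 : 1 <= 2 ^+ m :> int by rewrite exprn_ege1.
have q0 : 1 <= jacobsthal m by lia.
case: splitP => j _.
  have : `|(-2) ^+ j : int| <= 2 ^+ m.
    by rewrite normrX /= ler_weXn2l// ltnW.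
  have := jacobsthalE j; rewrite /third; nia.
have Mj : 2 ^+ j <= 2 ^+ m :> int by rewrite ler_weXn2l// ltnW.
have j0 : 0 < 2 ^+ j :> int by rewrite exprn_gt0.
rewrite /third; nia.
Qed.

(** * The theorem *)

Lemma cvg_half_odd_powers (R : realType) : 
   (fun k => (2^-1 : R) ^+ k.*2.+1) @ \oo --> (0 : R).
Proof.
have -> : (fun k => (2^-1 : R) ^+ k.*2.+1) = (fun k => 2^-1 * (2^-1 ^+ 2) ^+ k).
  by apply/funext => k; rewrite exprS -muln2 mulnC exprM.
rewrite -[X in _ --> X](mulr0 (2^-1 : R)); apply: cvgM; first exact: cvg_cst.
by apply: cvg_expr; rewrite ger0_norm; lra.
Qed.

Theorem theorem1p2 (R : realType) :
  (forall (eps : R) (n t : nat) (A : {fset int}),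
      0 < eps -> eps < 1 -> (0 < n)%N -> (0 < t)%N ->
      t%:R < (1 + eps) ^+ n ->
      #|` A| = n -> all_positive A -> sumset_distinct (2 ^ n + t)%N A ->
      (max_elt A)%:~R >= (1 - eps) * ((2 ^ n + t)%N%:R / 3)) /\
  (exists (n_ N_ : nat -> nat) (A_ : nat -> {fset int}),
      [/\ (forall k, (0 < n_ k)%N /\ (0 < N_ k)%N),
          n_ @ \oo --> \oo,
          (exists2 d : nat -> R, d @ \oo --> 0 &
             forall k, (N_ k)%:R = (1 + d k) * 2 ^+ n_ k),
          (forall k, [/\ #|` A_ k| = n_ k, all_positive (A_ k)
                       & sumset_distinct (N_ k) (A_ k)]) &
          (exists2 d : nat -> R, d @ \oo --> 0 &
             forall k, (max_elt (A_ k))%:~R <= (1 / 3 + d k) * (N_ k)%:R)]).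
Proof.
split=> [eps n t A e0 e1 n0 _ tn An posA sdA|]; first exact: max_elt_ge.
(* The set has 2m elements with m = 2k + 1 odd, and h k = 2^(-m). Then
   N = 2^(2m) (1 + h + h^2) and 2^m = h 2^(2m) <= h N. *)
pose m k := k.*2.+1.
have mo k : odd (m k) by rewrite /m /= odd_double.
pose h k : R := 2^-1 ^+ m k.
have h0 : h @ \oo --> 0 by exact: cvg_half_odd_powers.
have hE k : h k * 2 ^+ m k = 1 by rewrite /h exprVn mulVf// expf_neq0.
exists (fun k => (m k + m k)%N), (fun k => third_modulus (m k)),
  (fun k => [fset @third_family (m k) i | i in 'I_(m k + m k)]%fset).
have NE k : (third_modulus (m k))%:R = 2 ^+ m k * (2 ^+ m k + 1) + 1 :> R.
  by rewrite /third_modulus -addn1 natrD natrM -[(2 ^ _).+1]addn1 natrD natrX.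
split.
- by [].
- apply/cvgnyPge => B; exists B => // k /= Bk; rewrite /m; lia.
- exists (fun k => h k + h k * h k).
    have : (h k + h k * h k) @[k --> \oo] --> (0 + 0 * 0 : R).
      by apply: cvgD => //; exact: cvgM.
    by rewrite mulr0 addr0.
  move=> k; rewrite NE exprD; have := hE k.
  set M := 2 ^+ m k; set H := h k => HM.
  transitivity (M * M + H * M * M + (H * M) * (H * M)); last by ring.
  by rewrite HM; ring.
- move=> k; have df := third_family_dissociated (mo k); split.
  + exact: dissociated_card df.
  + by move=> _ /imfsetP[i _ ->]; exact: (third_family_bounds i (mo k)).1.
  + exact: dissociated_distinct df.
- exists h => // k; set A := imfset _ _ _.
  have bound : 3 * max_elt A <= (third_modulus (m k))%:Z + 2 ^+ m k.
    have : (max_elt A <= ((third_modulus (m k))%:Z + 2 ^+ m k) %/ 3)%Z.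
      rewrite /max_elt big_seq; apply: bigmax_le => [|_ /imfsetP[i _ ->]].
        by rewrite divz_ge0// addr_ge0// exprn_ge0.
      by have := (third_family_bounds i (mo k)).2; lia.
    by lia.
  have : 3 * (max_elt A)%:~R <= (third_modulus (m k))%:R + 2 ^+ m k :> R.
    by move: bound; rewrite -(ler_int R) intrM intrD rmorphXn.
  have M0 : 0 < 2 ^+ m k :> R by rewrite exprn_gt0.
  have H0 : 0 < h k by rewrite exprn_gt0// invr_gt0.
  have -> : 2 ^+ m k = h k * (2 ^+ m k * 2 ^+ m k) :> R by rewrite mulrA hE mul1r.
  rewrite NE; nra.
Qed.
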